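(* Let $G$ be a finitely generated torsion-free nilpotent group and let $\phi:H\to G$ be a contracting surjective virtual endomorphism ($H<G$ of finite index) such that the associated self-similar action $(G,X^* )$ is faithful. Let $L$ be the simply connected nilpotent Lie group containing $G$ and $H$ as uniform lattices (the Malcev completion), let $\phi_L$ be the contracting automorphism of $L$ extending $\phi$, and let $\Phi:\mathcal{X}_G\to L$ be a $G$-equivariant homeomorphism such that, for some fixed $x_0\in X$ and $g_0\in G$, $\phi_L(\Phi(t))=\Phi(\tau_{x_0}(t)\cdot g_0)$ for every $t\in\mathcal{X}_G$. Then the push-forward $\Phi_*\mu$ of the measure $\mu$ on the limit $G$-space $\mathcal{X}_G$ is a (right) Haar measure on the Lie group $L$.
   Context: Let $X$ be a finite nonempty set, $X^*$ the set of finite words over $X$, and $X^{-\omega}$ the space of left-infinite sequences $\ldots x_2x_1$, $x_i\in X$, with the product topology. A (left) action of a group $G$ on $X^*$ is self-similar if it is faithful and for every $g\in G$, $x\in X$ there exist $h\in G$, $y\in X$ such that $g(xw)=y\,h(w)$ for all $w\in X^*$; then $h$ is denoted $g|_x$, and $g|_{x_1\ldots x_n}=g|_{x_1}|_{x_2}\cdots|_{x_n}$. The action is contracting if there is a finite set $\mathcal{N}\subset G$ such that for every $g\in G$ there is $k$ with $g|_v\in\mathcal{N}$ for all words $v$ of length $\ge k$. The action associated with $\phi:H\to G$, $[G:H]=|X|$, is defined by choosing a left coset transversal $\{g_x\}_{x\in X}$ for $H$ and elements $\{h_x\}_{x\in X}\subset G$, and setting $g(x)=x'$, $g|_x=h_{x'}^{-1}\phi(g_{x'}^{-1}gg_x)h_x$,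 where $x'$ is the unique letter with $g_{x'}^{-1}gg_x\in H$; $\phi$ is contracting if this action is contracting (this, as well as faithfulness, does not depend on the choices). Two elements $\ldots x_2x_1\cdot g$ and $\ldots y_2y_1\cdot h$ of $X^{-\omega}\times G$ ($G$ discrete) are asymptotically equivalent if there are a finite set $K\subset G$ and $g_n\in K$, $n\ge1$, with $g_n(x_n\ldots x_1)=y_n\ldots y_1$ and $g_n|_{x_n\ldots x_1}\cdot g=h$ for all $n\ge 1$. The limit $G$-space $\mathcal{X}_G$ is the quotient topological space of $X^{-\omega}\times G$ by this relation, with the right $G$-action by multiplication on the $G$-coordinate; $G$ acts on $L$ by right translations. For $x\in X$, $\tau_x(\ldots x_2x_1\cdot g)=\ldots x_2x_1g(x)\cdot g|_x$ is a well-defined continuous self-map of $\mathcal{X}_G$. The measure $\mu$ on $\mathcal{X}_G$ is the push-forward, under the quotient map, of the product of the uniform Bernoulli measure on $X^{-\omega}$ (each letter has weight $1/|X|$) and the counting measure on $G$. Known facts that make the setting meaningful: under these hypotheses $\phi$ is an isomorphism $H\to G$, it extends to an automorphism $\phi_L$ of $L$ that is contracting (its iterates move every point to the identity), and a homeomorphism $\Phi$ as in the claim exists. *)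

(* Defs.v *)
From HB Require Import structures.
From mathcomp Require Import all_boot all_order all_algebra.
From mathcomp Require Import all_classical all_reals all_analysis.

Set Implicit Arguments.
Unset Strict Implicit.
Unset Printing Implicit Defensive.

Import Order.TTheory GRing.Theory Num.Theory.
Import numFieldNormedType.Exports.

Local Open Scope classical_set_scope.
Local Open Scope ring_scope.
Local Open Scope group_scope.
Local Open Scope quotient_scope.

(* Nonempty finite sets: measurable types are pointed in MathComp-Analysis,
   and the distinguished point has no other role. *)
#[short(type="pfinType")]
HB.structure Definition PointedFinite := {T of Finite T & Pointed T}.

Definition subgroup (G : groupType) (A : set G) : Prop :=
  [/\ A 1, forall x y, A x -> A y -> A (x * y) & forall x, A x -> A x^-1].

Definition generated (G : groupType) (A : set G) : set G := smallest (@subgroup G) A.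

Definition finitely_generated (G : groupType) : Prop :=
  exists2 A : set G, finite_set A & generated A = setT.

Definition torsion_free (G : groupType) : Prop :=
  forall (g : G) (n : nat), (0 < n)%N -> g ^+ n = 1 -> g = 1.

Fixpoint lower_central (G : groupType) (k : nat) {struct k} : set G :=
  if k is k'.+1 then
    generated [set z | exists x y, lower_central k' x /\ z = [~ x, y]]
  else setT.

Definition nilpotent_group (G : groupType) : Prop :=
  exists k, @lower_central G k = [set 1].

(* The value [ve_map g] is only meaningful for [g] in [ve_dom]. *)
Record virtual_endo (G : groupType) := VirtualEndo {
  ve_dom : set G;
  ve_map : G -> G;
  ve_dom_subgroup : subgroup ve_dom;
  ve_mapM : forall g h, ve_dom g -> ve_dom h ->
    ve_map (g * h) = ve_map g * ve_map h }.

(* Since it is indexed by the finite type [X], a transversal witnesses that the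
   index of [H] is finite and equal to [#|X|]. *)
Record left_transversal (G : groupType) (H : set G) (X : finType) :=
  LeftTransversal {
    tv :> X -> G;
    tvP : forall g, exists! x, H ((tv x)^-1 * g) }.

(* [ss_act g x] is $g(x)$ and [ss_sec g x] is $g|_x$.  Faithfulness is not part
   of the structure, see [faithful_action]. *)
Record wreath_recursion (G : groupType) (X : finType) := WreathRecursion {
  ss_act : G -> X -> X;
  ss_sec : G -> X -> G;
  ss_act1 : forall x, ss_act 1 x = x;
  ss_actM : forall g h x, ss_act (g * h) x = ss_act g (ss_act h x);
  ss_sec1 : forall x, ss_sec 1 x = 1;
  ss_secM : forall g h x,
    ss_sec (g * h) x = ss_sec g (ss_act h x) * ss_sec h x }.

Section WordAction.
Variables (G : groupType) (X : finType) (A : wreath_recursion G X).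

Fixpoint word_act (g : G) (w : seq X) : seq X :=
  if w is x :: w' then ss_act A g x :: word_act (ss_sec A g x) w' else [::].

Fixpoint word_sec (g : G) (w : seq X) : G :=
  if w is x :: w' then word_sec (ss_sec A g x) w' else g.

Definition faithful_action : Prop :=
  forall g h, (forall w, word_act g w = word_act h w) -> g = h.

Definition contracting_action : Prop :=
  exists2 N : set G, finite_set N &
    forall g, exists k, forall v : seq X, (k <= size v)%N -> N (word_sec g v).

Lemma word_act1 w : word_act 1 w = w.
Proof. by elim: w => //= x w IH; rewrite ss_act1 ss_sec1 IH. Qed.

Lemma word_sec1 w : word_sec 1 w = 1.
Proof. by elim: w => //= x w IH; rewrite ss_sec1. Qed.

Lemma word_actM g h w : word_act (g * h) w = word_act g (word_act h w).
Proof. by elim: w g h => //= x w IH g h; rewrite ss_actM ss_secM IH. Qed.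

Lemma word_secM g h w :
  word_sec (g * h) w = word_sec g (word_act h w) * word_sec h w.
Proof. by elim: w g h => //= x w IH g h; rewrite ss_secM IH. Qed.

Lemma word_act_rcons g w x :
  word_act g (rcons w x) = rcons (word_act g w) (ss_act A (word_sec g w) x).
Proof. by elim: w g => //= y w IH g; rewrite IH. Qed.

Lemma word_sec_rcons g w x :
  word_sec g (rcons w x) = ss_sec A (word_sec g w) x.
Proof. by elim: w g => //= y w IH g; rewrite IH. Qed.

End WordAction.

Section AssociatedAction.
Variables (G : groupType) (X : finType) (phi : virtual_endo G).
Variables (T : left_transversal (ve_dom phi) X) (h : X -> G).

Definition coset_letter (g : G) : X := sval (cid (tvP T g)).

Definition assoc_act (g : G) (x : X) : X := coset_letter (g * T x).

Definition assoc_sec (g : G) (x : X) : G :=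
  let x' := assoc_act g x in
  (h x')^-1 * ve_map phi ((T x')^-1 * g * T x) * h x.

Lemma coset_letterP g : ve_dom phi ((T (coset_letter g))^-1 * g).
Proof. by rewrite /coset_letter; case: cid => x []. Qed.

Lemma coset_letter_uniq g x : ve_dom phi ((T x)^-1 * g) -> coset_letter g = x.
Proof. by rewrite /coset_letter; case: cid => y /= [_ +] /[dup] => /[apply]. Qed.

Lemma assoc_actP g x : ve_dom phi ((T (assoc_act g x))^-1 * g * T x).
Proof. by rewrite -mulgA; exact: coset_letterP. Qed.

Lemma ve_map1 : ve_map phi 1 = 1.
Proof.
have [p1 _ _] := ve_dom_subgroup phi.
by apply: (mulgI (ve_map phi 1)); rewrite -ve_mapM // !mulg1.
Qed.

Lemma assoc_act1 x : assoc_act 1 x = x.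
Proof.
apply: coset_letter_uniq; rewrite mul1g mulVg.
by have [] := ve_dom_subgroup phi.
Qed.

Lemma assoc_split g k x (y := assoc_act k x) z :
  (T z)^-1 * (g * k) * T x = ((T z)^-1 * g * T y) * ((T y)^-1 * k * T x).
Proof. by rewrite !mulgA mulgK. Qed.

Lemma assoc_actM g k x : assoc_act (g * k) x = assoc_act g (assoc_act k x).
Proof.
apply: coset_letter_uniq; rewrite mulgA assoc_split.
by have [_ + _] := ve_dom_subgroup phi; apply; exact: assoc_actP.
Qed.

Lemma assoc_sec1 x : assoc_sec 1 x = 1.
Proof. by rewrite /assoc_sec assoc_act1 mulg1 mulVg ve_map1 mulg1 mulVg. Qed.

Lemma assoc_secM g k x :
  assoc_sec (g * k) x = assoc_sec g (assoc_act k x) * assoc_sec k x.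
Proof.
rewrite /assoc_sec assoc_actM assoc_split ve_mapM ?mulgA ?mulgK //;
  exact: assoc_actP.
Qed.

Definition assoc_action : wreath_recursion G X :=
  WreathRecursion assoc_act1 assoc_actM assoc_sec1 assoc_secM.

End AssociatedAction.

(* The left-infinite sequence $\ldots x_2x_1$ is represented by the function
   sending [i] to $x_{i+1}$. *)
Definition left_inf (X : choiceType) : Type :=
  {ptws nat -> discrete_topology X}.
HB.instance Definition _ (X : choiceType) := Topological.on (left_inf X).
HB.instance Definition _ (X : pfinType) :=
  isPointed.Build (left_inf X) (fun=> point : X).

(* The word $x_n\ldots x_1$, with $x_n$ as its first letter. *)
Definition left_word (X : choiceType) (s : left_inf X) (n : nat) : seq X :=
  rev (mkseq s n).

Definition discrete_group (G : groupType) : Type := G.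
HB.instance Definition _ (G : groupType) := Group.on (discrete_group G).
HB.instance Definition _ (G : groupType) :=
  Topological.copy (discrete_group G) (discrete_topology G).
HB.instance Definition _ (G : groupType) :=
  isPointed.Build (discrete_group G) (1 : G).

Definition borel (T : ptopologicalType) : Type := g_sigma_algebraType (@open T).
HB.instance Definition _ (T : ptopologicalType) := Measurable.on (borel T).

Section LimitSpace.
Variables (G : groupType) (X : pfinType) (A : wreath_recursion G X).

Definition limit_pre : Type := (left_inf X * discrete_group G)%type.
HB.instance Definition _ := Topological.on limit_pre.
HB.instance Definition _ := Pointed.on limit_pre.

Definition asymptotic (u v : limit_pre) : Prop :=
  exists2 K : set G, finite_set K &
    exists k : nat -> G, (forall n, (0 < n)%N -> K (k n)) /\
      forall n, (0 < n)%N ->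
        word_act A (k n) (left_word u.1 n) = left_word v.1 n /\
        word_sec A (k n) (left_word u.1 n) * u.2 = v.2.

Lemma asymptotic_refl u : asymptotic u u.
Proof.
exists [set 1] => //; exists (fun=> 1); split=> // n _.
by rewrite word_act1 word_sec1 mul1g.
Qed.

Lemma asymptotic_sym u v : asymptotic u v -> asymptotic v u.
Proof.
move=> [K finK [k [Kk kP]]]; exists [set x^-1 | x in K].
  exact: finite_image.
exists (fun n => (k n)^-1); split=> [n n0|n n0]; first by exists (k n) => //; exact: Kk.
have [<- <-] := kP n n0; split; first by rewrite -word_actM mulVg word_act1.
by rewrite mulgA -word_secM mulVg word_sec1 mul1g.
Qed.

Lemma asymptotic_trans u v w : asymptotic u v -> asymptotic v w -> asymptotic u w.
Proof.
move=> [K finK [k [Kk kP]]] [K' finK' [k' [Kk' kP']]].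
exists [set x.1 * x.2 | x in K' `*` K].
  by apply: finite_image; exact: finite_setX.
exists (fun n => k' n * k n); split=> n n0.
  by exists (k' n, k n) => //; split; [exact: Kk'|exact: Kk].
have [a1 a2] := kP n n0; have [b1 b2] := kP' n n0.
by rewrite word_actM word_secM a1 -mulgA a2.
Qed.

Definition asymptotic_rel : rel limit_pre := fun u v => `[< asymptotic u v >].

Lemma asymptotic_equiv : equiv_class_of asymptotic_rel.
Proof.
split=> [u|u v|v u w]; first by apply/asboolP; exact: asymptotic_refl.
  by apply/asboolP/asboolP => /asymptotic_sym.
by move=> /asboolP uv /asboolP vw; apply/asboolP; exact: asymptotic_trans uv vw.
Qed.

Canonical asymptotic_equiv_rel := EquivRelPack asymptotic_equiv.

Definition limit_space : Type :=
  quotient_topology {eq_quot asymptotic_equiv_rel}.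
HB.instance Definition _ := PointedTopological.on limit_space.
HB.instance Definition _ := Quotient.on limit_space.

Definition limit_pi (u : limit_pre) : limit_space := \pi_limit_space u.

Lemma limit_piP u v : limit_pi u = limit_pi v <-> asymptotic u v.
Proof.
by split=> [/eqquotP/asboolP|uv]; last by apply/eqquotP/asboolP.
Qed.

Lemma limit_repr u : asymptotic (repr (limit_pi u)) u.
Proof. by apply/limit_piP; rewrite /limit_pi reprK. Qed.

Definition pre_mul (u : limit_pre) (g : G) : limit_pre := (u.1, u.2 * g).

Definition limit_mul (t : limit_space) (g : G) : limit_space :=
  limit_pi (pre_mul (repr t) g).

Lemma limit_mulE u g : limit_mul (limit_pi u) g = limit_pi (pre_mul u g).
Proof.
apply/limit_piP; have [K finK [k [Kk kP]]] := limit_repr u.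
exists K => //; exists k; split=> // n n0; have [kP1 kP2] := kP n n0.
by rewrite /pre_mul /= mulgA kP2.
Qed.

Definition pre_tau (x : X) (u : limit_pre) : limit_pre :=
  ((fun i => if i is j.+1 then u.1 j else ss_act A u.2 x), ss_sec A u.2 x).

Definition limit_tau (x : X) (t : limit_space) : limit_space :=
  limit_pi (pre_tau x (repr t)).

Lemma left_word_tau x u n :
  left_word (pre_tau x u).1 n.+1 = rcons (left_word u.1 n) (ss_act A u.2 x).
Proof.
rewrite /left_word /mkseq /= rev_cons -[1%N]addn0 iotaDl -map_comp.
by congr (rcons (rev _) _); apply: eq_map.
Qed.

Lemma pre_tau_asymptotic x u v :
  asymptotic u v -> asymptotic (pre_tau x u) (pre_tau x v).
Proof.
move=> [K finK [k [Kk kP]]].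
exists (K `|` [set v.2 * u.2^-1]); first by rewrite finite_setU.
exists (fun n => if n is m.+2 then k m.+1 else v.2 * u.2^-1).
split=> [[//|[|n]] _|[//|[|n]] _]; [by right|by left; exact: Kk| |].
  rewrite !left_word_tau /left_word /=.
  by rewrite -ss_actM -ss_secM mulgVK.
have [kP1 kP2] := kP n.+1 isT.
rewrite !left_word_tau word_act_rcons word_sec_rcons kP1 /=.
by rewrite -ss_actM -ss_secM kP2.
Qed.

Lemma limit_tauE x u : limit_tau x (limit_pi u) = limit_pi (pre_tau x u).
Proof. by apply/limit_piP/pre_tau_asymptotic; exact: limit_repr. Qed.

(* Uniform Bernoulli measures are characterized by their values on the
   cylinders. *)
Definition uniform_bernoulli (R : realType)
    (beta : probability (borel (left_inf X)) R) : Prop :=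
  forall (n : nat) (w : nat -> X),
    beta [set s : left_inf X | forall i, (i < n)%N -> s i = w i] =
    ((#|X|%:R ^- n)%R%:E)%E.

Definition limit_measure (R : realType)
    (beta : probability (borel (left_inf X)) R) :
    set (borel limit_space) -> \bar R :=
  pushforward (beta \x^ (@counting (borel (discrete_group G)) R))%E
    (limit_pi : borel (left_inf X) * borel (discrete_group G) ->
      borel limit_space).

End LimitSpace.

Arguments limit_measure {G X} A {R} beta.

HB.mixin Record isTopologicalGroup L & Group L & Topological L := {
  mulg_continuous : continuous (fun x : L * L => x.1 * x.2);
  invg_continuous : continuous (fun x : L => x^-1) }.

(* The distinguished point is required by [borel] only. *)
#[short(type="topologicalGroupType")]
HB.structure Definition TopologicalGroup :=
  {L of Group L & PointedTopological L & isTopologicalGroup L}.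

(* On open sets [U], this is the usual notion of a function of class C^k. *)
Fixpoint Ck_on (R : realType) (m n k : nat) (U : set 'rV[R]_m)
    (f : 'rV[R]_m -> 'rV[R]_n) : Prop :=
  if k is k'.+1 then
    (forall x, U x -> differentiable f x) /\
    (forall v, Ck_on k' U (fun x => 'D_v f x))
  else forall x, U x -> {for x, continuous f}.

Definition smooth_on (R : realType) (m n : nat) (U : set 'rV[R]_m)
    (f : 'rV[R]_m -> 'rV[R]_n) : Prop := forall k, Ck_on k U f.

Record chart (R : realType) (n : nat) (M : topologicalType) := Chart {
  ch_dom : set M;
  ch_map : M -> 'rV[R]_n;
  ch_inv : 'rV[R]_n -> M;
  ch_dom_open : open ch_dom;
  ch_img_open : open (ch_map @` ch_dom);
  ch_map_continuous : forall x, ch_dom x -> {for x, continuous ch_map};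
  ch_inv_continuous :
    forall v, (ch_map @` ch_dom) v -> {for v, continuous ch_inv};
  ch_mapK : forall x, ch_dom x -> ch_inv (ch_map x) = x }.

Definition ch_img (R : realType) (n : nat) (M : topologicalType)
  (c : chart R n M) : set 'rV[R]_n := ch_map c @` ch_dom c.

Definition smooth_in_charts (R : realType) (n : nat) (M : topologicalType)
    (atlas : set (chart R n M)) (f : M -> M) : Prop :=
  continuous f /\
  forall c c', atlas c -> atlas c' ->
    smooth_on [set v | ch_img c v /\ ch_dom c' (f (ch_inv c v))]
      (fun v => ch_map c' (f (ch_inv c v))).

(* In [lie_mul_smooth], the product manifold is given the product charts,
   with R^n x R^n identified with R^(n + n). *)
Record lie_structure (R : realType) (n : nat) (L : topologicalGroupType) :=
  LieStructure {
    lie_hausdorff : hausdorff_space L;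
    lie_second_countable : @second_countable L;
    lie_atlas : set (chart R n L);
    lie_atlas_cover : forall x, exists2 c, lie_atlas c & ch_dom c x;
    lie_atlas_compatible : smooth_in_charts lie_atlas id;
    lie_mul_smooth : forall c1 c2 c3,
      lie_atlas c1 -> lie_atlas c2 -> lie_atlas c3 ->
      smooth_on
        [set w : 'rV[R]_(n + n) |
          [/\ ch_img c1 (lsubmx w), ch_img c2 (rsubmx w) &
              ch_dom c3 (ch_inv c1 (lsubmx w) * ch_inv c2 (rsubmx w))]]
        (fun w => ch_map c3 (ch_inv c1 (lsubmx w) * ch_inv c2 (rsubmx w)));
    lie_inv_smooth : smooth_in_charts lie_atlas (fun x => x^-1) }.

Definition lie_automorphism (R : realType) (n : nat) (L : topologicalGroupType)
    (S : lie_structure R n L) (f : L -> L) : Prop :=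
  [/\ {morph f : x y / x * y},
      smooth_in_charts (lie_atlas S) f &
      exists f', [/\ cancel f f', cancel f' f &
                     smooth_in_charts (lie_atlas S) f']].

Definition contracting_map (L : topologicalGroupType) (f : L -> L) : Prop :=
  forall l, (fun k => iter k f l) @ \oo --> (1 : L).

(* Trivial fundamental group: homotopies of loops are relative to the base
   point [x]; [F (s, t)] has deformation parameter [s]. *)
Definition simply_connected (R : realType) (M : topologicalType) : Prop :=
  (forall x y : M, exists f : R -> M,
     [/\ {within `[0%R, 1%R], continuous f}, f 0%R = x & f 1%R = y]) /\
  (forall (x : M) (f : R -> M),
     {within `[0%R, 1%R], continuous f} -> f 0%R = x -> f 1%R = x ->
     exists F : R * R -> M,
       [/\ {within `[0%R, 1%R] `*` `[0%R, 1%R], continuous F},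
           forall t, (0 <= t <= 1)%R -> F (0%R, t) = f t,
           forall t, (0 <= t <= 1)%R -> F (1%R, t) = x &
           forall s, (0 <= s <= 1)%R -> F (s, 0%R) = x /\ F (s, 1%R) = x]).

Definition homeomorphism (M N : topologicalType) (f : M -> N) : Prop :=
  continuous f /\
  exists f' : N -> M, [/\ continuous f', cancel f f' & cancel f' f].

Definition left_coset (G : groupType) (A : set G) (x : G) : set G :=
  [set x * a | a in A].

Definition right_translate (G : groupType) (A : set G) (x : G) : set G :=
  [set a * x | a in A].

Section CosetSpace.
Variables (L : topologicalGroupType) (Gamma : set L).

Definition coset_rel : rel L :=
  fun x y => `[< left_coset Gamma x = left_coset Gamma y >].

Lemma coset_equiv : equiv_class_of coset_rel.
Proof.
split=> [x|x y|y x z]; first exact/asboolP.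
  by apply/asboolP/asboolP => ->.
by move=> /asboolP xy /asboolP yz; apply/asboolP; rewrite xy.
Qed.

Canonical coset_equiv_rel := EquivRelPack coset_equiv.

Definition coset_space : Type := quotient_topology {eq_quot coset_equiv_rel}.

Definition uniform_lattice : Prop :=
  [/\ subgroup Gamma,
      forall x, Gamma x -> exists2 U, nbhs x U & U `&` Gamma = [set x] &
      compact [set: coset_space]].

End CosetSpace.

(* Haar measures are required to be Radon measures: this is the content of the
   three middle clauses. *)
Definition right_haar (R : realType) (L : topologicalGroupType)
    (nu : {measure set (borel L) -> \bar R}) : Prop :=
  [/\ nu setT <> 0%E,
      forall K : set L, compact K -> (nu K < +oo)%E,
      forall B : set (borel L), measurable B ->
        nu B = ereal_inf [set nu U | U in [set U : set L | open U /\ B `<=` U]],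
      forall U : set L, open U ->
        nu U = ereal_sup [set nu K | K in [set K : set L | compact K /\ K `<=` U]] &
      forall (B : set (borel L)) (l : L), measurable B ->
        nu (right_translate B l) = nu B].

(* Main.v *)
Require Import Defs.
From HB Require Import structures.
From mathcomp Require Import all_boot all_order all_algebra.
From mathcomp Require Import finmap.
From mathcomp Require Import all_classical all_reals all_analysis.

Set Implicit Arguments.
Unset Strict Implicit.
Unset Printing Implicit Defensive.

Import Order.TTheory GRing.Theory Num.Theory.
Import numFieldNormedType.Exports.

Local Open Scope classical_set_scope.
Local Open Scope ring_scope.
Local Open Scope group_scope.

(* Let M be the product of the Bernoulli and the counting measure on
   X^{-omega} x G, and let Psi be the composition of Phi with the quotient map.
   Since phi is a bijection H -> G, the map g |-> (g(x0), g|_x0) is a bijection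
   G -> X x G; hence (w, g) |-> (w g(x0), g|_x0 g0) is a bijection of
   X^{-omega} x G that divides M by |X|.  It covers phi_L, so nu = Psi_* M
   satisfies nu(phi_L B) = nu(B) / |X|.  As nu is invariant under the right
   translations by G, it is therefore invariant under those by phi_L^k(G) for
   all k.  The union of these subgroups is dense: L is the product of the
   compact tile Psi(X^{-omega} x {1}) and G, and phi_L contracts the tile
   uniformly to 1.  Finally nu is a Radon measure, and for such measures
   invariance under a dense set of translations implies invariance under all
   of them. *)

Lemma countable_range (T : Type) (D : set T) (x0 : T) :
  countable D -> D x0 -> exists e : nat -> T, range e = D.
Proof.
move=> cD Dx0; have /pfcard_geP[D0|[e]] := cD.
  by move: Dx0; rewrite D0.
by exists e; rewrite image_eq.
Qed.

(** * Regularity of Borel measures on locally compact, second countable Hausdorff spaces *)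

Section LocallyCompactBorel.
Variable L : ptopologicalType.
Hypothesis L_haus : hausdorff_space L.
Hypothesis L_sc : @second_countable L.
Hypothesis L_lc : forall (x : L) U, nbhs x U ->
  exists K, [/\ nbhs x K, compact K & K `<=` U].

(** By local compactness, the members of a countable base whose closures are compact and lie in [U]
    already cover [U]. The enumeration puts [set0] in place of the other members. *)
Lemma open_sigma_compact (U : set L) : open U ->
  exists F : (set L)^nat, (forall i, compact (F i)) /\ U = \bigcup_i F i.
Proof.
move=> oU; have [B cB [oB Bbase]] := L_sc.
have [V0 BV0] : exists V0, B V0.
  by case: (Bbase point setT filterT) => V0 [BV0 _] _; exists V0.
have [e eB] := countable_range cB BV0.
pose P V := compact (closure V) /\ closure V `<=` U.
exists (fun i => if `[< P (e i) >] then closure (e i) else set0); split.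
  by move=> i; case: asboolP => [[]//|_]; exact: compact0.
apply/seteqP; split=> [x Ux|x [i _] /=]; last first.
  by case: asboolP => // -[_]; apply.
have [K [nK cK KU]] := L_lc (open_nbhs_nbhs (conj oU Ux)).
have [V [BV Vx] VK] := Bbase x K nK.
have VcK : closure V `<=` K.
  rewrite [X in _ `<=` X](closure_id _).1; first exact: closure_subset.
  exact: compact_closed.
have [i _ ei] : range e V by rewrite eB.
exists i => //=; case: asboolP => [_|[]]; first by rewrite ei; exact: subset_closure.
rewrite ei; split; last exact: subset_trans KU.
by apply: subclosed_compact cK VcK; exact: closed_closure.
Qed.

Lemma borel_open (U : set L) : open U -> measurable (U : set (borel L)).
Proof. by move=> oU; apply: sub_sigma_algebra. Qed.

Lemma borel_closed (C : set L) : closed C -> measurable (C : set (borel L)).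
Proof.
move=> cC; rewrite -(setCK C); apply: measurableC; apply: borel_open.
exact: closed_openC.
Qed.

Lemma borel_compact (K : set L) : compact K -> measurable (K : set (borel L)).
Proof. by move=> cK; apply: borel_closed; exact: compact_closed. Qed.

Section Regularity.
Variable R : realType.
Local Open Scope ereal_scope.

(** Approximation from both sides at once is symmetric under complements, which exchange the closed
    and the open set; regularity from one side alone is not. *)
Definition squeezed (m : set (borel L) -> \bar R) (B : set (borel L)) :=
  forall e : R, (0 < e)%R -> exists C U : set L,
    [/\ closed C, open U, C `<=` B, B `<=` U & m (U `\` C) < e%:E].

(** The squeezed sets form a sigma-algebra containing the open sets. An open [U] is exhausted by
    compact sets [C n], and the mass of what remains tends to 0 by continuity from above, which
    needs [m] finite. *)
Lemma finite_squeezed (m : {measure set (borel L) -> \bar R}) B :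
  m setT < +oo -> measurable B -> squeezed m B.
Proof.
move=> moo; apply: (@smallest_sub _ _ (@open L)); last first.
  move=> U oU e e0; have [F [cF UF]] := open_sigma_compact oU.
  pose C n := \big[setU/set0]_(i < n) F i.
  have cC n : closed (C n).
    apply: closed_bigsetU => i _; apply: compact_closed => //; exact: cF.
  have mono : {homo (fun n => U `\` C n) : n k / (n <= k)%N >-> (k <= n)%O}.
    move=> n k nk; apply/subsetPset; apply: setDS; exact: subset_bigsetU.
  have cap : \bigcap_n (U `\` C n) = set0.
    apply/seteqP; split=> // x Ux; have [Ux1 _] := Ux 0%N I.
    move: Ux1; rewrite UF => -[i _ Fx]; have [_] := Ux i.+1 I.
    by apply; rewrite /C big_ord_recr /=; right.
  have := @nonincreasing_cvg_mu _ _ _ m (fun n => U `\` C n).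
  rewrite cap measure0 => /(_ _ _ measurable0 mono).
  have mC n : measurable (U `\` C n : set (borel L)).
    by apply: measurableD; [exact: borel_open|exact: borel_closed].
  have fin0 : m (U `\` C 0%N) < +oo.
    by apply: le_lt_trans moo; apply: le_measure; rewrite ?inE//; exact: mC.
  move=> /(_ fin0 mC) cv.
  have /cv [N _ HN] : nbhs (0%R : \bar R) [set x | x < e%:E].
    by apply: open_nbhs_nbhs; split; [exact: open_ereal_lt_ereal|rewrite /= lte_fin].
  exists (C N), U; split=> //; last exact: (HN N (leqnn _)).
  by rewrite /C -bigcup_mkord UF; exact: bigcup_subset.
split.
- move=> e e0; exists set0, set0; split=> //; [exact: closed0|exact: open0|].
  by rewrite setD0 measure0 lte_fin.
- move=> A hA e e0; have [C [U [cC oU CA AU mUC]]] := hA e e0.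
  exists (~` U), (~` C); split=> //; [exact: open_closedC|exact: closed_openC| | |].
  + by rewrite setTD; exact: subsetC.
  + by rewrite setTD; exact: subsetC.
  + by rewrite setDE setCK setIC -setDE.
move=> A hA e e0.
have e20 n : (0 < e / 2 / (2 ^ n.+1)%:R)%R.
  by rewrite !divr_gt0// ltr0n expn_gt0.
have /choice [CU hCU] : forall n, exists CU : set L * set L,
    [/\ closed CU.1, open CU.2, CU.1 `<=` A n, A n `<=` CU.2 &
        m (CU.2 `\` CU.1) < (e / 2 / (2 ^ n.+1)%:R)%R%:E].
  by move=> n; have [C [U H]] := hA n _ (e20 n); exists (C, U).
(* A countable union of closed sets may fail to be closed, so only finite unions [CC N] are removed
   from [UU]. What remains in the limit has mass at most e / 2, hence some [N] brings the mass below
   e. *)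
pose C n := (CU n).1; pose U n := (CU n).2.
pose UU := \bigcup_n U n; pose CC N := \big[setU/set0]_(i < N) C i.
have oUU : open UU by apply: bigcup_open => n _; have [] := hCU n.
have cCC N : closed (CC N).
  by apply: closed_bigsetU => i _; have [] := hCU i.
have mD N : measurable (UU `\` CC N : set (borel L)).
  by apply: measurableD; [exact: borel_open|exact: borel_closed].
have mono : {homo (fun n => UU `\` CC n) : n k / (n <= k)%N >-> (k <= n)%O}.
  move=> n k nk; apply/subsetPset; apply: setDS; exact: subset_bigsetU.
have mcap : measurable (\bigcap_n (UU `\` CC n) : set (borel L)).
  by apply: bigcapT_measurable => n; exact: mD.
have fin0 : m (UU `\` CC 0%N) < +oo.
  by apply: le_lt_trans moo; apply: le_measure; rewrite ?inE//; exact: mD.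
have cv := @nonincreasing_cvg_mu _ _ _ m _ fin0 mD mcap mono.
have capE : m (\bigcap_n (UU `\` CC n)) <= (e / 2)%:E.
  have mUC n : measurable (U n `\` C n : set (borel L)).
    have [cC oU _ _ _] := hCU n.
    by apply: measurableD; [exact: borel_open|exact: borel_closed].
  apply: le_trans (@measure_sigma_subadditive _ _ _ m _
    (fun n => U n `\` C n) mUC mcap _) _.
    move=> x Hx; have [[n _ Unx] _] := Hx 0%N I; exists n => //; split=> // Cx.
    by have [_] := Hx n.+1 I; apply; rewrite /CC big_ord_recr /=; right.
  apply: le_trans (@epsilon_trick0 R (e / 2) xpredT _); last by rewrite divr_ge0// ltW.
  apply: lee_nneseries => [n _ _|n _]; first exact: measure_ge0.
  by have [_ _ _ _ /ltW] := hCU n.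
have /cv [N _ HN] : nbhs (m (\bigcap_n (UU `\` CC n))) [set x | x < e%:E].
  apply: open_nbhs_nbhs; split; first exact: open_ereal_lt_ereal.
  apply: le_lt_trans capE _.
  by rewrite lte_fin ltr_pdivrMr// ltr_pMr// ltr1n.
exists (CC N), UU; split=> //; last exact: (HN N (leqnn _)).
- rewrite /CC -bigcup_mkord => x [i _ Cx]; exists i => //.
  by have [_ _ + _ _] := hCU i; exact.
- by move=> x [i _ Ax]; exists i => //; have [_ _ _ + _] := hCU i; exact.
Qed.

Variable nu : {measure set (borel L) -> \bar R}.
Hypothesis nuK : forall K : set L, compact K -> nu K < +oo.

(** The finite case applies to the restrictions of [nu] to countably many open sets [V i] of finite
    mass that cover the space; the errors e / 2^(i+1) add up to e. *)
Lemma outer_regular (B : set (borel L)) : measurable B ->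
  nu B = ereal_inf [set nu U | U in [set U : set L | open U /\ B `<=` U]].
Proof.
move=> mB; apply/eqP; rewrite eq_le; apply/andP; split.
  apply: le_ereal_inf_tmp => _ [U [oU BU] <-].
  by apply: le_measure; rewrite ?inE//; exact: borel_open.
apply/lee_addgt0Pr => e e0.
have [F [cF FT]] := open_sigma_compact (@openT L).
(* Finitely many interiors of compact neighbourhoods cover [F i]; their union lies in a compact set
   and so has finite mass. *)
have /choice [V hV] : forall i, exists V : set L,
    [/\ open V, F i `<=` V & nu V < +oo].
  move=> i; have /choice [K hK] : forall x : L, exists K, nbhs x K /\ compact K.
    by move=> x; have [K [? ? _]] := L_lc (@filterT _ _ (nbhs_filter x)); exists K.
  have := cF i; rewrite compact_cover => /(_ _ setT (fun x => (K x)°)).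
  have -> : (forall x : L, [set: L] x -> open (K x)°) <-> True.
    by split=> // _ x _; exact: open_interior.
  move=> /(_ I) [x _|D _ cov]; first by exists x => //; have [] := hK x.
  exists (\bigcup_(x in [set` D]) (K x)°); split=> //.
    by apply: bigcup_open => x _; exact: open_interior.
  have cKD : compact (\big[setU/set0]_(x <- D) K x).
    by apply: bigsetU_compact => x _; have [] := hK x.
  apply: le_lt_trans (nuK cKD); apply: le_measure; rewrite ?inE.
  - by apply: borel_open; apply: bigcup_open => x _; exact: open_interior.
  - exact: borel_compact.
  - by rewrite -bigcup_fset => y [x Dx Kx]; exists x => //; exact: interior_subset.
have mV i : measurable (V i : set (borel L)).
  by have [oV _ _] := hV i; exact: borel_open.
have e20 n : (0 < e / (2 ^ n.+1)%:R)%R by rewrite divr_gt0// ltr0n expn_gt0.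
have /choice [U hU] : forall i, exists U : set L,
    [/\ open U, B `<=` U & nu ((U `\` B) `&` V i) < (e / (2 ^ i.+1)%:R)%:E].
  move=> i; have fin : mrestr nu (mV i) setT < +oo.
    by rewrite /mrestr setTI; have [] := hV i.
  have [C [U [cC oU CB BU lt]]] := finite_squeezed fin mB (e20 i).
  exists U; split=> //; apply: le_lt_trans lt; rewrite /= /mrestr.
  apply: le_measure; rewrite ?inE.
  - apply: measurableI => //; apply: measurableD => //; exact: borel_open.
  - apply: measurableI => //.
    by apply: measurableD; [exact: borel_open|exact: borel_closed].
  - by apply: setSI; exact: setDS.
(* Cutting [U i] down to [V i] keeps only the region where its excess over [B] is controlled; since
   the [V i] cover the space, [W] still contains [B]. *)
pose W := \bigcup_i (U i `&` V i).
have oW : open W.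
  by apply: bigcup_open => i _; apply: openI; [have [] := hU i|have [] := hV i].
have BW : B `<=` W.
  move=> x Bx; have : [set: L] x by [].
  rewrite FT => -[i _ Fx]; exists i => //; split.
    by have [_ + _] := hU i; apply.
  by have [_ + _] := hV i; apply.
apply: le_trans (_ : nu W <= _); first by apply: ereal_inf_lbound; exists W.
have mW := borel_open oW.
have mWB : measurable (W `\` B : set (borel L)) by exact: measurableD.
have -> : W = B `|` (W `\` B) by rewrite setDUK.
apply: le_trans (measureU2 _ mB mWB) _; rewrite leeD2l//.
have mUB i : measurable ((U i `\` B) `&` V i : set (borel L)).
  apply: measurableI => //; apply: measurableD => //; apply: borel_open.
  by have [] := hU i.
apply: le_trans (@measure_sigma_subadditive _ _ _ nu _ _ mUB mWB _) _.
  by move=> x [[i _ [Ux Vx]] Bx]; exists i.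
apply: le_trans (@epsilon_trick0 R e xpredT _); last exact: ltW.
apply: lee_nneseries => [n _ _|n _]; first exact: measure_ge0.
by have [_ _ /ltW] := hU n.
Qed.

(** Finite unions of the compact pieces of [U] increase to [U], so continuity from below gives the
    supremum. *)
Lemma inner_regular (U : set L) : open U ->
  nu U = ereal_sup [set nu K | K in [set K : set L | compact K /\ K `<=` U]].
Proof.
move=> oU; apply/eqP; rewrite eq_le; apply/andP; split; last first.
  apply: ge_ereal_sup => _ [K [cK KU] <-].
  by apply: le_measure; rewrite ?inE//; [exact: borel_compact|exact: borel_open].
have [F [cF UF]] := open_sigma_compact oU.
pose C n := \big[setU/set0]_(i < n) F i.
have cC n : compact (C n) by apply: bigsetU_compact => i _; exact: cF.
have CE : \bigcup_n C n = U.
  rewrite UF; apply/seteqP; split=> x [n _].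
    by rewrite /C -bigcup_mkord => -[i _ Fx]; exists i.
  by move=> Fx; exists n.+1 => //; rewrite /C big_ord_recr /=; right.
have mC n : measurable (C n : set (borel L)) by exact: borel_compact.
have mono : {homo C : n k / (n <= k)%N >-> (n <= k)%O}.
  by move=> n k nk; apply/subsetPset; exact: subset_bigsetU.
have := @nondecreasing_cvg_mu _ _ _ nu C mC _ mono.
rewrite CE => /(_ (borel_open oU)) cv.
rewrite -(cvg_lim _ cv)//; apply: lime_le; first by apply/cvg_ex; eexists; exact: cv.
apply: nearW => n /=; apply: ereal_sup_ubound; exists (C n) => //; split=> //.
by rewrite -CE; exact: bigcup_sup.
Qed.

End Regularity.
End LocallyCompactBorel.

Lemma continuous_borel_measurable (T1 T2 : ptopologicalType) (f : T1 -> T2) :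
  continuous f -> measurable_fun setT (f : borel T1 -> borel T2).
Proof.
move=> /continuousP cf.
apply: (@measurability _ _ (borel T1) (borel T2) setT f (@open T2)) => //.
by move=> _ [B oB <-]; rewrite setTI; apply: sub_sigma_algebra; exact: cf.
Qed.

(** * Topological groups: translates, discrete subgroups, local compactness of Lie groups *)

Section TopologicalGroupTheory.
Variable L : topologicalGroupType.
Implicit Types (x y l : L) (A K U : set L).

Lemma mulr_continuous l : continuous (fun x : L => x * l).
Proof.
move=> x; apply: (@continuous_comp _ _ _ (fun y : L => (y, l))
  (fun z : L * L => z.1 * z.2)).
  by apply: cvg_pair => //=; exact: cvg_cst.
exact: mulg_continuous.
Qed.

Lemma right_translateE A l : right_translate A l = (fun x => x * l^-1) @^-1` A.
Proof.
apply/seteqP; split=> [_ [a Aa <-]|x Ax] /=; first by rewrite mulgK.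
by exists (x * l^-1) => //; rewrite mulgVK.
Qed.

Lemma right_translateK A l : right_translate (right_translate A l) l^-1 = A.
Proof.
by rewrite !right_translateE invgK; apply/seteqP; split=> x /=; rewrite mulgK.
Qed.

Lemma right_translateS A A' l :
  A `<=` A' -> right_translate A l `<=` right_translate A' l.
Proof. exact: image_subset. Qed.

Lemma open_right_translate U l : open U -> open (right_translate U l).
Proof.
rewrite right_translateE; move: U; apply/continuousP; exact: mulr_continuous.
Qed.

Lemma measurable_right_translate (B : set (borel L)) l :
  measurable B -> measurable (right_translate B l : set (borel L)).
Proof.
move=> mB; rewrite right_translateE -[X in measurable X]setTI.
by apply: (continuous_borel_measurable (@mulr_continuous l^-1)).
Qed.

(** This is the tube lemma for multiplication, with compactness used in its near-covering form. *)
Lemma near_right_translate K U l : compact K -> open U ->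
  right_translate K l `<=` U -> \forall l' \near l, right_translate K l' `<=` U.
Proof.
move=> /compact_near_coveringP cK oU KU.
have := cK L (nbhs l) (fun l' x => U (x * l')) _.
move=> H; suff : \near l, K `<=` (fun x => U (x * l)).
  by apply: filterS => l' KU' _ [x Kx <-]; exact: KU'.
apply: H => x Kx.
have Uxl : nbhs (x * l) U by apply: open_nbhs_nbhs; split=> //; apply: KU; exists x.
have := @mulg_continuous L (x, l) U Uxl.
by case=> -[P Q] /= [nP nQ] PQ; exists (P, Q).
Qed.

(** Continuity of y^-1 z at (x, x), where its value is 1. It serves as the smallness condition of
    the left uniform structure. *)
Lemma ldiv_near x U : nbhs (1 : L) U ->
  exists2 W, nbhs x W & forall y z, W y -> W z -> U (y^-1 * z).
Proof.
move=> nU; have := @mulg_continuous L (x^-1, x) U; rewrite /= mulVg => /(_ nU).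
move=> [[P Q] /= [nP nQ] PQ].
exists ((fun y => y^-1) @^-1` P `&` Q).
  by apply: filterI nQ; exact: invg_continuous nP.
by move=> y z [Py _] [_ Qz]; exact: (PQ (y^-1, z)).
Qed.

(** Two elements y, z of [Gamma] in the same [W x] have y^-1 z in [U] and in [Gamma], hence equal to
    1. So each [W x] contains at most one element of [Gamma], and finitely many [W x] cover [K]. *)
Lemma finite_compactI_discrete (Gamma : set L) K : subgroup Gamma ->
  (forall x, Gamma x -> exists2 U, nbhs x U & U `&` Gamma = [set x]) ->
  compact K -> finite_set (K `&` Gamma).
Proof.
move=> [G1 GM GV] dG cK.
have [U nU UG] := dG 1 G1.
have /choice [W hW] : forall x : L, exists W : set L,
    nbhs x W /\ forall y z, W y -> W z -> U (y^-1 * z).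
  by move=> x; have [W ? ?] := ldiv_near x nU; exists W.
move: cK; rewrite compact_cover => /(_ _ setT (fun x => (W x)°)) [|x _|D _ cov].
- by move=> x _; exact: open_interior.
- by exists x => //; have [nW _] := hW x; exact: nW.
have fin x : finite_set (W x `&` Gamma).
  have [->|/set0P [y [Wy Gy]]] := eqVneq (W x `&` Gamma) set0; first exact: finite_set0.
  apply: sub_finite_set (finite_set1 y) => z [Wz Gz] /=.
  have [_ hx] := hW x.
  have : (U `&` Gamma) (y^-1 * z).
    by split; [exact: hx|apply: GM => //; exact: GV].
  by rewrite UG /= => /(congr1 (fun t => y * t)); rewrite mulgA mulgV mul1g mulg1.
apply: sub_finite_set (bigcup_finite (finite_fset D) (fun x _ => fin x)).
move=> y [/cov [x Dx Wy] Gy]; exists x => //; split=> //; exact: interior_subset.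
Qed.

End TopologicalGroupTheory.

(** A closed ball in a chart is compact and is carried back to [L] by the continuous inverse chart.
    Halving the radius keeps the closed ball inside the open one on which the chart is
    controlled. *)
Lemma lie_compact_nbhs (R : realType) (n : nat) (L : topologicalGroupType)
  (S : lie_structure R n L) (x : L) (U : set L) : nbhs x U ->
  exists K, [/\ nbhs x K, compact K & K `<=` U].
Proof.
move=> nU; have [c _ cx] := lie_atlas_cover S x.
pose v := ch_map c x.
have imv : (ch_map c @` ch_dom c) v by exists x.
have nimg : nbhs v (ch_map c @` ch_dom c).
  by apply: open_nbhs_nbhs; split=> //; exact: ch_img_open.
have ninv : nbhs v (ch_inv c @^-1` U).
  by apply: ch_inv_continuous => //; rewrite ch_mapK.
have /(@nbhs_ballP R) [e /= e0 eN] : nbhs v (ch_map c @` ch_dom c `&` ch_inv c @^-1` U).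
  exact: filterI.
have e20 : (0 < e / 2)%R by rewrite divr_gt0.
have sub : closed_ball v (e / 2) `<=` ball v e.
  rewrite closed_ballE// -ball_normE => w /= /le_lt_trans; apply.
  by rewrite ltr_pdivrMr// ltr_pMr// ltr1n.
exists (ch_inv c @` closed_ball v (e / 2)); split.
- have nb : nbhs x (ch_map c @^-1` ball v (e / 2)).
    by apply: ch_map_continuous => //; exact: nbhsx_ballx.
  have nd : nbhs x (ch_dom c).
    by apply: open_nbhs_nbhs; split=> //; exact: ch_dom_open.
  apply: filterS (filterI nb nd) => y [by_ dy]; exists (ch_map c y).
    exact: subset_closed_ball.
  exact: ch_mapK.
- apply: continuous_compact.
    apply: continuous_in_subspaceT => w; rewrite inE => /sub/eN [iw _].
    exact: ch_inv_continuous.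
  apply: bounded_closed_compact; last exact: closed_ball_closed.
  rewrite closed_ballE//; exists (`|v| + e / 2)%R; split; first exact: num_real.
  move=> M vM w; rewrite /closed_ball_ /= => vw; apply: le_trans (ltW vM).
  by rewrite -(subrKC v w) (le_trans (ler_normD _ _))// lerD2l distrC.
- by move=> _ [w /sub/eN [_ ?] <-].
Qed.

(** * From a dense set of translations to all translations *)

Section DenseInvariance.
Variable L : topologicalGroupType.
Hypothesis L_haus : hausdorff_space L.
Hypothesis L_sc : @second_countable L.
Hypothesis L_lc : forall (x : L) U, nbhs x U ->
  exists K, [/\ nbhs x K, compact K & K `<=` U].
Local Open Scope ereal_scope.

(** If K is compact in an open U, then K s lies in U l for some s in [S] near l, so nu K = nu (K s)
    is at most nu (U l). Inner regularity gives one inequality for open sets and l^-1 the other;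
    outer regularity passes to Borel sets. *)
Lemma dense_right_invariant (R : realType) (nu : {measure set (borel L) -> \bar R})
    (S : set L) :
  (forall K : set L, compact K -> nu K < +oo) -> dense S ->
  (forall s (B : set (borel L)), S s -> measurable B ->
    nu (right_translate B s) = nu B) ->
  forall l (B : set (borel L)), measurable B -> nu (right_translate B l) = nu B.
Proof.
move=> nuK dS inv.
have leU (U : set L) l : open U -> nu U <= nu (right_translate U l).
  move=> oU; rewrite (inner_regular L_haus L_sc L_lc nu oU).
  apply: ge_ereal_sup => _ [K [cK KU] <-].
  have oUl := open_right_translate l oU.
  have nl := near_right_translate cK oUl (right_translateS KU).
  have [s [Ns Ss]] :
      [set l' | right_translate K l' `<=` right_translate U l]° `&` S !=set0.
    by apply: dS; [exists l; exact: nl|exact: open_interior].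
  have mK := borel_compact L_haus cK.
  rewrite -(inv s K Ss mK); apply: le_measure; rewrite ?inE.
  - exact: measurable_right_translate.
  - exact: borel_open.
  - exact: (interior_subset Ns).
have eqU (U : set L) l : open U -> nu (right_translate U l) = nu U.
  move=> oU; apply/eqP; rewrite eq_le leU// andbT.
  have := leU _ (l^-1)%g (open_right_translate l oU).
  by rewrite right_translateK.
have leB (B : set (borel L)) l : measurable B -> nu (right_translate B l) <= nu B.
  move=> mB; rewrite (outer_regular L_haus L_sc L_lc nuK mB).
  apply: le_ereal_inf_tmp => _ [U [oU BU] <-]; rewrite -(eqU U l oU).
  apply: le_measure; rewrite ?inE; last exact: right_translateS.
  - exact: measurable_right_translate.
  - by apply: borel_open; exact: open_right_translate.
move=> l B mB; apply/eqP; rewrite eq_le leB//=.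
by have := leB _ (l^-1)%g (measurable_right_translate l mB); rewrite right_translateK.
Qed.

End DenseInvariance.

Lemma pushforward_is_measure d d' (T1 : measurableType d)
    (T2 : measurableType d') (R : realFieldType)
    (m : {measure set T1 -> \bar R}) (f : T1 -> T2) :
  measurable_fun [set: T1] f ->
  exists nu : {measure set T2 -> \bar R}, forall B, nu B = pushforward m f B.
Proof.
move=> mf; unshelve eexists.
  by unshelve refine [the measure _ _ of pushforward m f].
by [].
Qed.

(** * The product measure on sequences and group elements, computed on boxes *)

Section PreLimitSpace.
Variables (G : groupType) (X : pfinType).
Implicit Types (w : nat -> X) (g : G).

Definition cylinder (n : nat) w : set (left_inf X) :=
  [set s | forall i, (i < n)%N -> s i = w i].

Definition box (n : nat) w g : set (limit_pre G X) :=
  [set u | cylinder n w u.1 /\ u.2 = g].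

Lemma cylinder_open n w : open (cylinder n w).
Proof.
have -> : cylinder n w = \bigcap_(i in `I_n) [set s : left_inf X | s i = w i].
  by apply/seteqP; split=> s /= H i /H.
rewrite bigcap_mkord; elim/big_ind : _ => [|A B|i _]; [exact: openT|exact: openI|].
have /(@continuousP (left_inf X) (discrete_topology X)) :=
  @proj_continuous nat (fun=> discrete_topology X) i.
by move=> /(_ [set w i]); apply; exact: discrete_open.
Qed.

(** The filter generated by the cylinders around [s] converges to [s] in every coordinate, hence in
    the topology of pointwise convergence. *)
Lemma nbhs_cylinder (s : left_inf X) U : nbhs s U -> exists n, cylinder n s `<=` U.
Proof.
pose F := filter_from [set: nat] (fun n => cylinder n s).
have FF : Filter F.
  apply: filter_from_filter; first by exists 0%N.
  move=> i j _ _; exists (maxn i j) => // t H; split=> k ki; apply: H.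
    exact: leq_trans ki (leq_maxl _ _).
  exact: leq_trans ki (leq_maxr _ _).
have /(@pointwise_cvgP nat (discrete_topology X) F s) Fs : forall t,
    (fun g : nat -> discrete_topology X => g t) @ F --> (s t : discrete_topology X).
  move=> t A /nbhs_singleton As; exists t.+1 => //= r /(_ t (ltnSn t)) /= rt.
  by rewrite /= rt.
by move=> /Fs [n _ nU]; exists n.
Qed.

Lemma box_open n w g : open (box n w g).
Proof.
rewrite openE => -[s a] [/= sw /= ->]; exists (cylinder n w, [set g]) => //=.
split; first by apply: open_nbhs_nbhs; split=> //; exact: cylinder_open.
apply: open_nbhs_nbhs; split=> //; exact: (@discrete_open (discrete_topology G)).
Qed.

Lemma nbhs_box (u : limit_pre G X) U : nbhs u U -> exists n, box n u.1 u.2 `<=` U.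
Proof.
case: u => s g [[P Q] /= [/nbhs_cylinder [n nP] /nbhs_singleton Qg] PQU].
by exists n => -[t a] [/= ts /= ->]; apply: PQU; split=> //; exact: nP.
Qed.

(** The empty set is included to make the boxes a pi-system. *)
Definition boxes : set (set (limit_pre G X)) :=
  [set B | B = set0 \/ exists n w g, B = box n w g].

Lemma boxes_setI : setI_closed boxes.
Proof.
move=> _ _ [->|[n [w [g ->]]]] [->|[m [v [k ->]]]]; rewrite ?set0I ?setI0; do ?by left.
have [->|/set0P [[s a] [[/= sw ag] [/= sv ak]]]] := eqVneq (box n w g `&` box m v k) set0.
  by left.
right; exists (maxn n m), s, a; apply/seteqP; split=> -[t b] /=.
  move=> [[/= tw bg] [/= tv bk]]; split=> /=; last by rewrite bg.
  move=> i; rewrite leq_max => /orP[] H; [by rewrite tw// sw|by rewrite tv// sv].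
move=> [/= H /= ->]; split; split=> //= i lt_i.
  by rewrite H ?sw// (leq_trans lt_i)// leq_maxl.
by rewrite H ?sv// (leq_trans lt_i)// leq_maxr.
Qed.

Hypothesis G_countable : countable [set: G].

(** There are only countably many boxes, since finite words and [G] are countable, and [U] is the
    union of those inside it. *)
Lemma open_sigma_boxes (U : set (limit_pre G X)) : open U -> <<s boxes >> U.
Proof.
move=> oU.
have [e eG] := @countable_range _ _ (1%g : G) G_countable I.
(* A box is coded by a finite word and an index into the enumeration of [G]. The default letter
   [point] is read only beyond the length of the word, where the box imposes no condition. *)
pose bx (p : seq X * nat) := box (size p.1) (nth point p.1) (e p.2).
have -> : U = \bigcup_p (if `[< bx p `<=` U >] then bx p else set0).
  apply/seteqP; split=> [[s g] Usg|x [p _] /=]; last by case: asboolP => //; apply.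
  have /nbhs_box [n nU] := open_nbhs_nbhs (conj oU Usg).
  have [k _ ek] : range e g by rewrite eG.
  exists (mkseq s n, k) => //=.
  have -> : bx (mkseq s n, k) = box n s g.
    rewrite /bx /= size_mkseq ek; apply/seteqP; split=> -[t a] [/= ta /= ->].
      by split=> //= i ni; rewrite ta// nth_mkseq.
    by split=> //= i ni; rewrite ta// nth_mkseq.
  by case: asboolP => // _; split.
apply: (@countable_bigcupT_measurable _ (g_sigma_algebraType boxes)) => //.
move=> p; case: asboolP => _; last exact: (@measurable0 _ (g_sigma_algebraType boxes)).
apply: sub_sigma_algebra; right.
by exists (size p.1), (nth point p.1), (e p.2).
Qed.

Let preT := (borel (left_inf X) * borel (discrete_group G))%type.

(** This allows measures on the product to be compared on boxes, and it makes open sets measurable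
    for the product of the two Borel sigma-algebras. *)
Lemma measurable_pre : @measurable _ preT = <<s boxes >>.
Proof.
apply/seteqP; split.
  have mfst : measurable_fun setT
      (fst : g_sigma_algebraType boxes -> borel (left_inf X)).
    apply: (@measurability _ _ (g_sigma_algebraType boxes)
      (borel (left_inf X)) _ _ open) => //.
    move=> _ [A oA <-]; rewrite setTI; apply: open_sigma_boxes.
    by move: A oA; apply/continuousP => u; exact: cvg_fst.
  have msnd : measurable_fun setT
      (snd : g_sigma_algebraType boxes -> borel (discrete_group G)).
    apply: (@measurability _ _ (g_sigma_algebraType boxes)
      (borel (discrete_group G)) _ _ open) => //.
    move=> _ [A oA <-]; rewrite setTI; apply: open_sigma_boxes.
    by move: A oA; apply/continuousP => u; exact: cvg_snd.
  rewrite measurable_prod_measurableType.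
  apply: smallest_sub; first exact: smallest_sigma_algebra.
  move=> _ [A mA [B mB <-]].
  have mA' := mfst measurableT A mA; have mB' := msnd measurableT B mB.
  rewrite setTI in mA'; rewrite setTI in mB'.
  exact: (@measurableI _ (g_sigma_algebraType boxes) _ _ mA' mB').
apply: smallest_sub; first exact: sigma_algebra_measurable.
move=> _ [->|[n [w [g ->]]]]; first exact: measurable0.
have -> : box n w g = cylinder n w `*` [set g] by [].
apply: (@measurableX _ _ (borel (left_inf X)) (borel (discrete_group G))).
  by apply: sub_sigma_algebra; exact: cylinder_open.
by apply: sub_sigma_algebra; exact: (@discrete_open (discrete_topology G)).
Qed.

Lemma open_pre_measurable (U : set (limit_pre G X)) : open U -> measurable (U : set preT).
Proof. by rewrite measurable_pre; exact: open_sigma_boxes. Qed.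

Variables (R : realType) (beta : probability (borel (left_inf X)) R).
Hypothesis beta_unif : uniform_bernoulli beta.
Local Open Scope ereal_scope.

Definition pre_measure : {measure set preT -> \bar R} :=
  (beta \x^ (@counting (borel (discrete_group G)) R))%E.

Lemma pre_measure_box n w g : pre_measure (box n w g) = (#|X|%:R ^- n)%R%:E.
Proof.
have -> : box n w g = cylinder n w `*` [set g] by [].
rewrite /pre_measure /= product_measure2E.
- have c1 : @counting (borel (discrete_group G)) R [set g] = 1.
    by rewrite /counting asboolT ?fset_set1 ?cardfs1//; exact: finite_set1.
  by rewrite [X in X * _](beta_unif n w) [X in _ * X]c1 mule1.
- by apply: sub_sigma_algebra; exact: cylinder_open.
- by apply: sub_sigma_algebra; exact: (@discrete_open (discrete_topology G)).
Qed.

(** Images under the bijection [f] are preimages under [f'], so both sides are measures in [A]. They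
    agree on the pi-system of boxes, as [f] lengthens each box by [k] letters, and the boxes of
    length 0 form a countable cover by sets of finite mass. *)
Lemma pre_measure_scaling (f f' : limit_pre G X -> limit_pre G X) k :
  cancel f f' -> cancel f' f ->
  (forall n w g, exists w' g', f @` box n w g = box (n + k) w' g') ->
  forall A : set preT, measurable A ->
    pre_measure (f @` A) = (#|X|%:R ^- k)%R%:E * pre_measure A.
Proof.
move=> fK f'K fbox.
have fE (A : set preT) : f @` A = f' @^-1` A.
  by apply/seteqP; split=> [_ [u Au <-]|u Au] /=; [rewrite fK|exists (f' u)].
have mf' : measurable_fun setT (f' : preT -> preT).
  apply: (@measurability _ _ preT preT setT f' boxes) => //; first exact: measurable_pre.
  move=> _ [B [->|[n [w [g ->]]]] <-]; rewrite setTI; first by rewrite preimage_set0.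
  rewrite -fE; have [w' [g' ->]] := fbox n w g.
  by apply: open_pre_measurable; exact: box_open.
have c0 : (0 <= (#|X|%:R ^- k : R))%R by rewrite invr_ge0 exprn_ge0.
have [m1 m1E] := pushforward_is_measure pre_measure mf'.
pose m2 := [the measure _ _ of mscale (NngNum c0) pre_measure].
move=> A mA; rewrite fE -[LHS]m1E.
have [e eG] := @countable_range _ _ (1%g : G) G_countable I.
have X0 : (#|X|%:R != 0 :> R)%R by rewrite pnatr_eq0 -lt0n; apply/card_gt0P; exists point.
apply: (@g_sigma_algebra_measure_unique _ R preT boxes _
  (fun i => box 0 (fun=> point) (e i)) _ _ m1 m2).
- by rewrite measurable_pre; exact: sub_sigma_algebra.
- by move=> i; right; exists 0%N, (fun=> point), (e i).
- apply/seteqP; split=> // -[s g] _; have [i _ ei] : range e g by rewrite eG.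
  by exists i.
- exact: boxes_setI.
- move=> _ [->|[n [w [g ->]]]]; first by rewrite !measure0.
  rewrite m1E /m2 /= /pushforward /mscale /= -fE; have [w' [g' ->]] := fbox n w g.
  by rewrite !pre_measure_box -EFinM exprD invfM mulrC.
- move=> i; rewrite m1E /= /pushforward -fE.
  have [w' [g' ->]] := fbox 0%N (fun=> point) (e i).
  by rewrite pre_measure_box ltry.
- by rewrite -measurable_pre.
Qed.

End PreLimitSpace.

(** * The shift on sequences and group elements that covers the automorphism *)

Section SelfSimilarity.
Variables (G : groupType) (X : pfinType).

Lemma pre_mul_box n (w : nat -> X) (a g : G) :
  (fun u => pre_mul u g) @` box n w a = box n w (a * g).
Proof.
apply/seteqP; split=> [_ [[s b] [/= sw ->] <-]//|[s b] [/= sw /= ->]].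
by exists (s, a).
Qed.

Variables (A : wreath_recursion G X) (x0 : X) (g0 : G).

(* The map of [limit_pre G X] inducing [fun t => limit_mul (limit_tau x0 t) g0]. *)
Definition pre_shift (u : limit_pre G X) : limit_pre G X :=
  pre_mul (pre_tau A x0 u) g0.

(** Each step adds a letter at index 0 and a new group element, both determined by the previous
    group element alone. *)
Lemma iter_pre_shift k (s t : left_inf X) (g : G) :
  (iter k pre_shift (s, g)).2 = (iter k pre_shift (t, g)).2 /\
  forall i, (i < k)%N -> (iter k pre_shift (s, g)).1 i = (iter k pre_shift (t, g)).1 i.
Proof.
elim: k => [|k [IH2 IH1]]; first by split.
rewrite !iterS /pre_shift /pre_mul /pre_tau /= IH2; split=> // -[|i] //= ik.
exact: IH1.
Qed.

Hypothesis section_surj : forall y b, exists g, ss_act A g x0 = y /\ ss_sec A g x0 = b.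
Hypothesis section_inj : forall g g',
  ss_act A g x0 = ss_act A g' x0 -> ss_sec A g x0 = ss_sec A g' x0 -> g = g'.

Definition pre_unshift (u : limit_pre G X) : limit_pre G X :=
  (fun i => u.1 i.+1, sval (cid (section_surj (u.1 0%N) (u.2 * g0^-1)))).

Lemma pre_shiftK : cancel pre_shift pre_unshift.
Proof.
move=> [s g]; rewrite /pre_unshift /=; congr pair.
by case: cid => g' [/= a1 a2]; apply: section_inj; rewrite // a2 mulgK.
Qed.

Lemma pre_unshiftK : cancel pre_unshift pre_shift.
Proof.
move=> [s g]; rewrite /pre_shift /pre_mul /pre_tau /pre_unshift /=.
case: cid => g' [/= a1 a2]; rewrite a1 a2 mulgVK; congr pair.
by apply/funext => -[].
Qed.

(** The group coordinate is constant on a box, so the added letter is too. This extra prescribed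
    letter is the source of the factor 1 / |X|. *)
Lemma pre_shift_box n (w : nat -> X) (g : G) :
  pre_shift @` box n w g =
  box (n + 1) (fun i => if i is j.+1 then w j else ss_act A g x0) (ss_sec A g x0 * g0).
Proof.
apply/seteqP; split=> [_ [[s b] [/= sw ->] <-]|u [/= uw ug]].
  split=> //= -[|i]//=; rewrite addn1 ltnS; exact: sw.
exists (pre_unshift u); last exact: pre_unshiftK.
split=> /= [i ni|]; first by rewrite uw// addn1 ltnS.
case: cid => g' [a1 a2]; apply: section_inj; first by rewrite a1 uw// addn1.
by rewrite a2 ug mulgK.
Qed.

End SelfSimilarity.

(** * Bijectivity of the pair of letter and section for the associated action *)

Section AssociatedBijection.
Variables (G : groupType) (X : finType) (phi : virtual_endo G).
Variables (T : left_transversal (ve_dom phi) X) (h : X -> G).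

Lemma assoc_section_surj : ve_map phi @` ve_dom phi = setT ->
  forall x y b, exists g, assoc_act T g x = y /\ assoc_sec T h g x = b.
Proof.
move=> surj x y b.
(* The section formula is solved for the argument of phi: [k] must equal [(T y)^-1 * g * T x], and
   this determines [g]. *)
have [k Hk phik] : (ve_map phi @` ve_dom phi) (h y * b * (h x)^-1) by rewrite surj.
pose g := T y * k * (T x)^-1.
have E : (T y)^-1 * g * T x = k by rewrite /g !mulgA mulVg mul1g mulgVK.
have a : assoc_act T g x = y.
  by apply: coset_letter_uniq; rewrite mulgA E.
by exists g; split; rewrite // /assoc_sec a E phik !mulgA mulVg mul1g mulgVK.
Qed.

(** With equal target letters, the outer factors of the two sections cancel and leave equal values
    of phi on elements of its domain. *)
Lemma assoc_section_inj : {in ve_dom phi &, injective (ve_map phi)} ->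
  forall x g g', assoc_act T g x = assoc_act T g' x ->
    assoc_sec T h g x = assoc_sec T h g' x -> g = g'.
Proof.
move=> inj x g g' a; rewrite /assoc_sec a => /mulIg/mulgI/inj.
rewrite !inE -{1}a => /(_ (assoc_actP T g x) (assoc_actP T g' x)).
by move=> /mulIg/mulgI.
Qed.

End AssociatedBijection.

(** * The induced measure on the Lie group and its invariance *)

Section LimitMeasure.
Variables (R : realType) (G : groupType) (X : pfinType) (A : wreath_recursion G X).
Variables (x0 : X) (g0 : G) (L : topologicalGroupType) (iota : G -> L).
Hypothesis L_haus : hausdorff_space L.
Hypothesis L_sc : @second_countable L.
Hypothesis L_lc : forall (x : L) U, nbhs x U ->
  exists K, [/\ nbhs x K, compact K & K `<=` U].
Hypothesis iota_inj : injective iota.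
Hypothesis iota_subgroup : subgroup (range iota).
Hypothesis iota_discrete : forall x, range iota x ->
  exists2 U, nbhs x U & U `&` range iota = [set x].
Variable Psi : limit_pre G X -> L.
Hypothesis Psi_continuous : continuous Psi.
Hypothesis Psi_surj : forall l, exists u, Psi u = l.
Hypothesis Psi_equiv : forall u g, Psi (pre_mul u g) = Psi u * iota g.

Lemma left_inf_compact : compact [set: left_inf X].
Proof.
have fX : finite_set [set: discrete_topology X] := @finite_finset X setT.
have := @tychonoff nat (fun=> discrete_topology X) (fun=> setT)
  (fun=> finite_compact fX).
by congr compact; apply/seteqP; split.
Qed.

Lemma tile_compact (F : set G) : finite_set F ->
  compact ([set: left_inf X] `*` (F : set (discrete_group G))).
Proof.
by move=> fF; apply: compact_setX; [exact: left_inf_compact|exact: finite_compact].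
Qed.

(** With [D] the compact tile, [Psi (s, g)] in [K] forces [iota g] into the compact set D^-1 K,
    which contains finitely many lattice points. *)
Lemma proper_finite (K : set L) : compact K ->
  finite_set [set g | exists s : left_inf X, K (Psi (s, g))].
Proof.
move=> cK; pose D := Psi @` ([set: left_inf X] `*` [set (1 : discrete_group G)]).
have cD : compact D.
  apply: continuous_compact; first exact: continuous_subspaceT.
  by apply: tile_compact; exact: finite_set1.
pose C := (fun z : L * L => z.1 * z.2) @` (((fun x : L => x^-1) @` D) `*` K).
have cC : compact C.
  apply: continuous_compact; first exact/continuous_subspaceT/mulg_continuous.
  apply: compact_setX => //; apply: continuous_compact => //.
  exact/continuous_subspaceT/invg_continuous.
have fC := finite_compactI_discrete iota_subgroup iota_discrete cC.
have := @finite_preimage _ _ _ iota (in2W iota_inj) fC.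
apply: sub_finite_set => g [s Ksg] /=.
split; last by exists g.
exists ((Psi (s, 1))^-1, Psi (s, g)); last first.
  have -> : (s, g) = pre_mul (s, 1) g by rewrite /pre_mul /= mul1g.
  by rewrite /= Psi_equiv mulgA mulVg mul1g.
split=> //=; exists (Psi (s, 1)) => //; exists (s, 1) => //.
Qed.

(** Each lattice point is isolated from the others by a member of a countable base, and distinct
    points get distinct members. *)
Lemma lattice_countable : countable [set: G].
Proof.
have [B cB [_ Bbase]] := L_sc.
have /choice [V hV] : forall g, exists V, [/\ B V, V (iota g) &
    forall g', V (iota g') -> g' = g].
  move=> g; have [U nU Ug] := iota_discrete (ex_intro2 _ _ g I erefl).
  have [V [BV Vg] VU] := Bbase _ U nU; exists V; split=> // g' Vg'.
  apply: iota_inj; have : (U `&` range iota) (iota g') by split; [exact: VU|exists g'].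
  by rewrite Ug.
have /countable_injP [f fB] := cB.
apply/countable_injP; exists (f \o V) => g g' _ _ /= fVgg'.
have [BVg Vg _] := hV g; have [BVg' _ hg'] := hV g'.
by apply: hg'; rewrite -(fB _ _ _ _ fVgg') ?inE.
Qed.

(** Uniform continuity of [Psi] on a compact set, with cylinder length as modulus: the claim holds
    near each point for all large [m], and compactness makes [m] uniform. *)
Lemma uniform_cylinders (F : set G) (W : set L) : finite_set F -> nbhs (1 : L) W ->
  exists m, forall (s t : left_inf X) a, F a -> (forall i, (i < m)%N -> s i = t i) ->
    W ((Psi (s, a))^-1 * Psi (t, a)).
Proof.
move=> /tile_compact/compact_near_coveringP nc nW.
pose P (m : nat) (u : limit_pre G X) := forall t : left_inf X,
  (forall i, (i < m)%N -> u.1 i = t i) -> W ((Psi u)^-1 * Psi (t, u.2)).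
have [|m _ mP] := nc nat \oo P _; last first.
  by exists m => s t a Fa; exact: (mP m (leqnn m) (s, a)).
move=> u _; have [N nN NW] := ldiv_near (Psi u) nW.
have /nbhs_box [n nU] := Psi_continuous nN.
exists (box n u.1 u.2, [set m | (n <= m)%N]).
  split=> /=; last by exists n.
  by apply: open_nbhs_nbhs; split; [exact: box_open|split].
move=> [[v b] m] [/= [/= vu bu] nm] t vt; apply: NW; apply: nU; split=> //=.
move=> i ni; rewrite -(vu i ni); apply/esym/vt; exact: leq_trans ni nm.
Qed.

Lemma Psi_measurable : measurable_fun setT
  (Psi : borel (left_inf X) * borel (discrete_group G) -> borel L).
Proof.
apply: (@measurability _ _ (borel (left_inf X) * borel (discrete_group G))%type
  (borel L) setT Psi open) => //.
move=> _ [U oU <-]; rewrite setTI; apply: (open_pre_measurable lattice_countable).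
by move: U oU; apply/continuousP.
Qed.

Variables phiL phiL' : L -> L.
Hypothesis phiLM : {morph phiL : x y / x * y}.
Hypothesis phiLK : cancel phiL phiL'.
Hypothesis phiL'K : cancel phiL' phiL.
Hypothesis phiL_continuous : continuous phiL.
Hypothesis phiL_contracting : contracting_map phiL.
Hypothesis phiL_Psi : forall u, phiL (Psi u) = Psi (pre_shift A x0 g0 u).

Lemma iter_phiL_Psi k u : iter k phiL (Psi u) = Psi (iter k (pre_shift A x0 g0) u).
Proof. by elim: k => //= k ->. Qed.

(* The k-th iterate of [phiL] maps the tile into [Psi (C_k, a_k)] for a cylinder
   [C_k] of length k and some [a_k] in [G]; since the iterates of a single point
   converge, the [a_k] eventually stay in a finite set. *)
Lemma tile_contracting (V : set L) : nbhs (1 : L) V ->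
  exists k, forall s : left_inf X, V (iter k phiL (Psi (s, 1))).
Proof.
move=> nV.
have [W nW WV] : exists2 W, nbhs (1 : L) W & forall y z, W y -> W z -> V (y * z).
  have := @mulg_continuous L (1, 1) V; rewrite /= mulg1 => /(_ nV) [[P Q] /= [nP nQ] PQ].
  exists (P `&` Q); first exact: filterI.
  by move=> y z [Py _] [_ Qz]; exact: (PQ (y, z)).
have [K [nK cK _]] := L_lc nW.
have [m hm] := uniform_cylinders (proper_finite cK) nW.
pose s0 : left_inf X := fun=> x0.
have [k0 _ hk] := @phiL_contracting (Psi (s0, 1)) _ (filterI nW nK).
(* Beyond [k0] the orbit of the reference point is in both [W] and [K], which puts its group
   coordinate in the finite set; at least [m] steps give enough common letters for every other
   [s]. *)
pose k := maxn k0 m; have [Wk Kk] := hk k (leq_maxl _ _).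
exists k => s.
rewrite -[X in V X](mulVKg (iter k phiL (Psi (s0, 1)))); apply: WV => //.
move: Kk; rewrite !iter_phiL_Psi.
have [] := iter_pre_shift A x0 g0 k s0 s 1.
case: (iter k _ (s0, 1)) => [t a]; case: (iter k _ (s, 1)) => [t' a'] /= <- tt' Kta.
by apply: hm => [|i im]; [exists t|apply: tt'; rewrite (leq_trans im)// leq_maxr].
Qed.

Definition lattice_iterates : set L := [set l | exists k g, l = iter k phiL (iota g)].

Lemma iter_phiLM k : {morph iter k phiL : x y / x * y}.
Proof. by elim: k => // k IH x y; rewrite !iterS IH phiLM. Qed.

(** Pulling l back by phi_L^k and writing the result as a tile point times a lattice point gives l =
    v phi_L^k(iota g), with v in the contracted tile. For large k, v is near 1, so v^-1 l stays in
    [U]. *)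
Lemma dense_lattice_iterates : dense lattice_iterates.
Proof.
move=> U [l Ul] oU.
have nV : nbhs (1 : L) [set v : L | U (v^-1 * l)].
  apply: (@invg_continuous L 1 [set v | U (v * l)]).
  apply: (@mulr_continuous L l); rewrite invg1 mul1g.
  by apply: open_nbhs_nbhs.
have [k hk] := tile_contracting nV.
have [[s g] Psig] := Psi_surj (iter k phiL' l).
have lE : l = iter k phiL (Psi (s, 1)) * iter k phiL (iota g).
  rewrite -iter_phiLM -Psi_equiv /pre_mul /= mul1g Psig.
  by elim: (k) => // j IH; rewrite iterSr iterS phiL'K.
exists (iter k phiL (iota g)); split; last by exists k, g.
by have := hk s; rewrite /= {1}lE mulKg.
Qed.

Hypothesis section_surj : forall y b, exists g, ss_act A g x0 = y /\ ss_sec A g x0 = b.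
Hypothesis section_inj : forall g g',
  ss_act A g x0 = ss_act A g' x0 -> ss_sec A g x0 = ss_sec A g' x0 -> g = g'.
Variable beta : probability (borel (left_inf X)) R.
Hypothesis beta_unif : uniform_bernoulli beta.
Variable nu : {measure set (borel L) -> \bar R}.
Hypothesis nuE : forall B, nu B = pre_measure G beta (Psi @^-1` B).
Local Open Scope ereal_scope.

Lemma measurable_Psi (B : set (borel L)) : measurable B ->
  measurable (Psi @^-1` B : set (borel (left_inf X) * borel (discrete_group G))).
Proof. by rewrite -[X in _ -> measurable X]setTI; exact: Psi_measurable. Qed.

(** The preimage of [K] involves only finitely many group elements, and each contributes mass at
    most 1. *)
Lemma nu_compact (K : set L) : compact K -> nu K < +oo.
Proof.
move=> cK; rewrite nuE; have fF := proper_finite cK.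
set F := [set g | _] in fF.
have mF : measurable (F : set (borel (discrete_group G))).
  by apply: sub_sigma_algebra; exact: (@discrete_open (discrete_topology G)).
have cF : @counting (borel (discrete_group G)) R F < +oo.
  by rewrite /counting asboolT// ltry.
apply: (@le_lt_trans _ _ (pre_measure G beta (setT `*` F))).
  apply: le_measure; rewrite ?inE.
  - by apply: measurable_Psi; exact: (borel_compact L_haus).
  - exact: measurableX.
  - by move=> [s g] /= Kg; split=> //; exists s.
rewrite /pre_measure /= product_measure2E// [X in X * _]probability_setT mul1e.
exact: cF.
Qed.

Lemma nu_lattice_translate g (B : set (borel L)) : measurable B ->
  nu (right_translate B (iota g)) = nu B.
Proof.
move=> mB; rewrite !nuE.
have -> : Psi @^-1` right_translate B (iota g) = (fun u => pre_mul u g) @` (Psi @^-1` B).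
  apply/seteqP; split=> [u|_ [u Bu <-]] /=.
    move=> [b Bb bu]; exists (pre_mul u g^-1%g); last first.
      by case: (u) => s a; rewrite /pre_mul /= mulgVK.
    suff <- : b = Psi (pre_mul u g^-1%g) by [].
    apply: (mulIg (iota g)); rewrite -Psi_equiv bu.
    by case: (u) => s a; rewrite /pre_mul /= mulgVK.
  by exists (Psi u) => //; rewrite Psi_equiv.
rewrite (pre_measure_scaling lattice_countable beta_unif (k := 0)
  (f := fun u => pre_mul u g) (f' := fun u => pre_mul u g^-1%g)).
- by rewrite expr0 invr1 mul1e.
- by move=> [s a]; rewrite /pre_mul /= mulgK.
- by move=> [s a]; rewrite /pre_mul /= mulgVK.
- by move=> n w a; exists w, (a * g)%g; rewrite addn0 pre_mul_box.
- exact: measurable_Psi.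
Qed.

Lemma nu_phiL (B : set (borel L)) : measurable B ->
  nu (phiL @` B) = (#|X|%:R ^- 1)%R%:E * nu B.
Proof.
move=> mB; rewrite !nuE.
have -> : Psi @^-1` (phiL @` B) = pre_shift A x0 g0 @` (Psi @^-1` B).
  apply/seteqP; split=> [u [b Bb bu]|_ [u Bu <-]] /=.
    exists (pre_unshift g0 section_surj u); last exact: pre_unshiftK.
    suff <- : b = Psi (pre_unshift g0 section_surj u) by [].
    by apply: (can_inj phiLK); rewrite phiL_Psi pre_unshiftK.
  by exists (Psi u); rewrite ?phiL_Psi.
rewrite (pre_measure_scaling lattice_countable beta_unif (k := 1)
  (pre_shiftK g0 section_surj section_inj)) //.
- exact: pre_unshiftK.
- by move=> n w g; eexists; eexists; exact: (pre_shift_box g0 section_surj section_inj).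
- exact: measurable_Psi.
Qed.

(** Induction on [k] by conjugation: translating by phi_L(s) amounts to applying phi_L^-1,
    translating by s and applying phi_L. The factor 1 / |X| occurs on both sides. *)
Lemma nu_iterate_translate k g (B : set (borel L)) : measurable B ->
  nu (right_translate B (iter k phiL (iota g))) = nu B.
Proof.
elim: k B => [|k IH] B mB /=; first exact: nu_lattice_translate.
have phiLB : phiL @` (phiL @^-1` B) = B.
  by apply: image_preimage; apply/seteqP; split=> // l _; exists (phiL' l).
have mphiB : measurable (phiL @^-1` B : set (borel L)).
  rewrite -[X in measurable X]setTI.
  exact: (continuous_borel_measurable phiL_continuous).
set s := iter k phiL (iota g).
have -> : right_translate B (phiL s) = phiL @` (right_translate (phiL @^-1` B) s).
  rewrite -{1}phiLB; apply/seteqP; split.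
    by move=> _ [_ [b Bb <-] <-]; exists (b * s)%g; [exists b|rewrite phiLM].
  by move=> _ [_ [b Bb <-] <-]; exists (phiL b); [exists b|rewrite phiLM].
rewrite nu_phiL; last exact: measurable_right_translate.
by rewrite IH// -nu_phiL// phiLB.
Qed.

Lemma nu_right_haar : right_haar nu.
Proof.
split.
- rewrite nuE preimage_setT => M0.
  (* A box of length 0 has mass 1, so the total mass cannot vanish. *)
  have : pre_measure G beta (box 0 (fun=> x0) 1%g) <= 0.
    rewrite -M0; apply: le_measure; rewrite ?inE.
    + by apply: (open_pre_measurable lattice_countable); exact: box_open.
    + exact: measurableT.
    + by [].
  by rewrite pre_measure_box// expr0 invr1 lee_fin ler10.
- exact: nu_compact.
- by move=> B mB; apply: outer_regular => //; exact: nu_compact.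
- by move=> U oU; exact: inner_regular.
- move=> B l mB; apply: (dense_right_invariant L_haus L_sc L_lc nu_compact
    dense_lattice_iterates) => //.
  by move=> _ C [k [g ->]] mC; exact: nu_iterate_translate.
Qed.

End LimitMeasure.

(** * Application to the associated action and the map [Phi] *)

Theorem proposition24
  (R : realType) (G : groupType) (X : pfinType)
  (hGfg : finitely_generated G) (hGtf : torsion_free G)
  (hGnil : nilpotent_group G)
  (phi : virtual_endo G)
  (T : left_transversal (ve_dom phi) X) (h : X -> G)
  (hphi_surj : ve_map phi @` ve_dom phi = setT)
  (hphi_contr : contracting_action (assoc_action T h))
  (hfaithful : faithful_action (assoc_action T h))
  (n : nat) (L : topologicalGroupType) (S : lie_structure R n L)
  (hLsc : simply_connected R L) (hLnil : nilpotent_group L)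
  (iota : G -> L)
  (hiotaM : {morph iota : x y / x * y}) (hiota_inj : injective iota)
  (hlatticeG : uniform_lattice (range iota))
  (hlatticeH : uniform_lattice (iota @` ve_dom phi))
  (phiL : L -> L)
  (hphiL_aut : lie_automorphism S phiL)
  (hphiL_ext : forall g, ve_dom phi g -> phiL (iota g) = iota (ve_map phi g))
  (hphiL_contr : contracting_map phiL)
  (Phi : limit_space (assoc_action T h) -> L)
  (hPhi_homeo : homeomorphism Phi)
  (hPhi_equiv : forall t g, Phi (limit_mul t g) = Phi t * iota g)
  (x0 : X) (g0 : G)
  (hPhi_tau : forall t, phiL (Phi t) = Phi (limit_mul (limit_tau x0 t) g0))
  (beta : probability (borel (left_inf X)) R)
  (hbeta : uniform_bernoulli beta) :
  exists nu : {measure set (borel L) -> \bar R},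
    (forall B : set (borel L), measurable B ->
       nu B = pushforward (limit_measure (assoc_action T h) beta)
                (Phi : borel (limit_space (assoc_action T h)) -> borel L) B) /\
    right_haar nu.
Proof.
have [iotaG dG _] := hlatticeG.
have L_haus := lie_hausdorff S; have L_sc := lie_second_countable S.
have L_lc := lie_compact_nbhs S.
have [phiLM [phiL_cont _] [phiL' [phiLK phiL'K _]]] := hphiL_aut.
have [Phi_cont [Phi' [_ _ Phi'K]]] := hPhi_homeo.
(* Injectivity of phi is inherited from the automorphism of [L] that extends it. *)
have phi_inj : {in ve_dom phi &, injective (ve_map phi)}.
  move=> g k; rewrite !inE => Hg Hk gk; apply: hiota_inj; apply: (can_inj phiLK).
  by rewrite !hphiL_ext// gk.
pose A := assoc_action T h; pose Psi := Phi \o @limit_pi G X A.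
have Psi_cont : continuous Psi by move: Phi_cont => /quotient_continuous.
have Psi_surj l : exists u, Psi u = l.
  by exists (repr (Phi' l)); rewrite /Psi /= /limit_pi reprK.
have Psi_equiv u g : Psi (pre_mul u g) = Psi u * iota g.
  by rewrite /Psi /= -hPhi_equiv limit_mulE.
have Psi_shift u : phiL (Psi u) = Psi (pre_shift A x0 g0 u).
  by rewrite /Psi /= hPhi_tau limit_tauE limit_mulE.
have mPsi := Psi_measurable L_sc hiota_inj dG Psi_cont.
have [nu nuE] := pushforward_is_measure (pre_measure G beta) mPsi.
(* Pushing forward first by the quotient map and then by [Phi] takes the same preimages as pushing
   forward by [Psi]. *)
exists nu; split=> [B _|]; first by rewrite nuE.
apply: (nu_right_haar L_haus L_sc L_lc hiota_inj iotaG dG Psi_cont Psi_surj Psi_equiv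
  phiLM phiLK phiL'K phiL_cont hphiL_contr Psi_shift _ _ hbeta nuE).
- by move=> y b; exact: assoc_section_surj.
- by move=> g g'; exact: assoc_section_inj.
Qed.
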